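(* Let $n$ be a positive integer and $d(n)$ the number of positive divisors of $n$. Let $\mathcal{D}_1(n)$ be the set of partitions of $n$ in which only the largest part may be repeated, and let $\mathcal{D}^{\ast}(n)$ be the set of $\pi\in\mathcal{D}_1(n)$ such that the largest part occurs exactly twice and $\#(\pi)\ge 3$. Then \[ d(n) = 1 + \left\lfloor\frac{n}{2}\right\rfloor - \sum_{\pi \in \mathcal{D}^{\ast}(n)} (-1)^{\#(\pi) - 1} \big(s_2(\pi) - s(\pi)\big). \]
   Context: For a partition $\pi$, $\#(\pi)$ is its number of parts, $s(\pi)$ its smallest part, and $s_2(\pi)$ its second smallest part. *)

(* Defs.v *)
From HB Require Import structures.
From mathcomp Require Import all_boot all_order all_algebra.

Set Implicit Arguments.
Unset Strict Implicit.
Unset Printing Implicit Defensive.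

(* Partitions are weakly decreasing lists of positive parts. *)
Definition is_intpart (n : nat) (s : seq nat) : bool :=
  [&& sorted geq s, 0 \notin s & sumn s == n].

Record intpart (n : nat) : Type :=
  IntPart { parts :> seq nat; partsP : is_intpart n parts }.

HB.instance Definition _ (n : nat) := [isSub for @parts n].
HB.instance Definition _ (n : nat) := [Countable of intpart n by <:].

(* A partition of n has at most n parts, each at most n, so it embeds in the
   finite type {bseq n of 'I_n.+1}. *)
Section IntPartFinite.
Variable n : nat.
Implicit Type p : intpart n.

Lemma leq_part_sumn (s : seq nat) (i : nat) : i \in s -> i <= sumn s.
Proof.
elim: s => //= x s IHs; rewrite inE => /predU1P[-> | /IHs le_i].
  exact: leq_addr.
exact: leq_trans le_i (leq_addl _ _).
Qed.

Lemma size_leq_sumn (s : seq nat) : 0 \notin s -> size s <= sumn s.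
Proof.
elim: s => //= x s IHs; rewrite inE negb_or eq_sym -lt0n => /andP[x_gt0 /IHs].
by move=> le_s; rewrite -add1n leq_add.
Qed.

Lemma intpart_size p : size (map (@inord n) p) <= n.
Proof.
rewrite size_map; case: p => s /= /and3P[_ s0 /eqP <-]; exact: size_leq_sumn.
Qed.

Definition intpart_bseq p : {bseq n of 'I_n.+1} := Bseq (intpart_size p).

Definition bseq_intpart (b : {bseq n of 'I_n.+1}) : option (intpart n) :=
  insub (map val b).

Lemma intpart_bseqK : pcancel intpart_bseq bseq_intpart.
Proof.
move=> p; rewrite /bseq_intpart /=.
suff -> : map val (map (@inord n) p) = p by rewrite valK.
rewrite -map_comp map_id_in // => i ip /=; rewrite inordK // ltnS.
by case: p ip => s /= /and3P[_ _ /eqP <-]; exact: leq_part_sumn.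
Qed.

HB.instance Definition _ : isFinite (intpart n) := PCanIsFinite intpart_bseqK.

End IntPartFinite.

Section IntPartStatistics.
Variable n : nat.
Implicit Type p : intpart n.

Definition num_parts p : nat := size p.
Definition largest p : nat := head 0 p.

(* Parts are counted with multiplicity: the two smallest parts are the last two
   entries of p.  On Dstar below the smallest part is not repeated. *)
Definition smallest p : nat := nth 0 (rev p) 0.
Definition second_smallest p : nat := nth 0 (rev p) 1.

End IntPartStatistics.

Definition D1 (n : nat) : {set intpart n} :=
  [set p : intpart n |
    all (fun i => (1 < count_mem i p) ==> (i == largest p)) p].

Definition Dstar (n : nat) : {set intpart n} :=
  [set p in D1 n | (count_mem (largest p) p == 2) && (3 <= num_parts p)].

(* Main.v *)
(* A partition in [Dstar n] is [:: L, L & t] with [t] a nonempty strictly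
   decreasing list of parts below [L].  Adding or omitting the part [L] shows
   that the generating functions [A_L] of the signed gaps [s_2 - s] satisfy
   [A_1 = 0] and [A_(L+1) = (1 - q^L) A_L + (q + ... + q^L)].  Comparing with
   [C_1 = 1], [C_(L+1) = (1 - q^L) C_L + 1], one finds
   [(1 - q) A_L = q (C_L - 1)], and telescoping gives
   [\sum_L q^(2L) A_L = \sum_(1 <= i <= L) q^(L+i) + q/(1-q) - \sum_L q^L C_L],
   whose first two terms generate [n %/ 2] and [1].  The last sum is
   [\sum_m m q^m (q^(m+1); q)_oo], which by Uchimura's identity is the Lambert
   series [\sum_k q^k/(1-q^k)] of the divisor function.  All of this takes place
   in a commutative ring where [q ^+ N = 0], so sums and products are finite;
   coefficients are read off in [Z[X]/(X^(n+1))]. *)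

Require Import Defs.
From mathcomp Require Import all_boot all_order all_algebra.
From mathcomp Require Import qpoly ring zify.

Set Implicit Arguments.
Unset Strict Implicit.
Unset Printing Implicit Defensive.

Import GRing.Theory.
Local Open Scope ring_scope.

(** * Finite q-products and their sums *)

Section QSeries.
Variables (R : comNzRingType) (q : R).

Lemma geometric_sum (x : R) n :
  (1 - x) * (\sum_(i < n) x ^+ i.+1) = x - x ^+ n.+1.
Proof.
elim: n => [|n IHn]; first by rewrite big_ord0; ring.
by rewrite big_ord_recr /= mulrDr IHn !exprS; ring.
Qed.

(** For [m <= n] this is the q-Pochhammer product [(q^(m+1); q)_(n-m)]. *)
Definition qprod m n : R := \prod_(m <= i < n) (1 - q ^+ i.+1).

Lemma qprod_nn n : qprod n n = 1.
Proof. by rewrite /qprod big_geq. Qed.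

Lemma qprod_recr m n :
  (m <= n)%N -> qprod m n.+1 = (1 - q ^+ n.+1) * qprod m n.
Proof. by move=> le_mn; rewrite /qprod big_nat_recr //= mulrC. Qed.

Lemma qprod_recl m n :
  (m < n)%N -> qprod m n = (1 - q ^+ m.+1) * qprod m.+1 n.
Proof. by move=> lt_mn; rewrite /qprod big_ltn. Qed.

(** This is [C_(n+1)]: indices here are one below the largest part [L]. *)
Definition qprod_sum n : R := \sum_(m < n.+1) qprod m n.

Lemma sum_qprod_recr (c : nat -> R) n :
  \sum_(m < n.+2) c m * qprod m n.+1 =
    (1 - q ^+ n.+1) * (\sum_(m < n.+1) c m * qprod m n) + c n.+1.
Proof.
rewrite big_ord_recr /= qprod_nn mulr1 mulr_sumr; congr (_ + _).
by apply: eq_bigr => m _; rewrite qprod_recr -1?ltnS // mulrCA.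
Qed.

Lemma qprod_sum0 : qprod_sum 0 = 1.
Proof. by rewrite /qprod_sum big_ord1 qprod_nn. Qed.

Lemma qprod_sumS n : qprod_sum n.+1 = (1 - q ^+ n.+1) * qprod_sum n + 1.
Proof.
have sum1 k : qprod_sum k = \sum_(m < k.+1) 1 * qprod m k.
  by apply: eq_bigr => m _; rewrite mul1r.
by rewrite !sum1 (sum_qprod_recr (fun=> 1)).
Qed.

Lemma sum_qpow_qprod n : \sum_(m < n.+1) q ^+ m * qprod m n = 1.
Proof.
elim: n => [|n IHn]; first by rewrite big_ord1 qprod_nn mulr1.
by rewrite sum_qprod_recr IHn; ring.
Qed.

Lemma sum_index_qpow_qprod n :
  \sum_(m < n.+1) (m%:R * q ^+ m) * qprod m n = n.+1%:R - qprod_sum n.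
Proof.
elim: n => [|n IHn]; first by rewrite qprod_sum0 big_ord1 !mul0r subrr.
by rewrite (sum_qprod_recr (fun m => m%:R * q ^+ m)) IHn qprod_sumS -!natr1; ring.
Qed.

(** Sharing its value with [sum_index_qpow_qprod], this turns the sum of the [q^L C_L] into the sum
    of the [m q^m (q^(m+1); q)_(n-m)] already at finite level. *)
Lemma sum_qpow_qprod_sum n :
  \sum_(k < n) q ^+ k.+1 * qprod_sum k = n.+1%:R - qprod_sum n.
Proof.
elim: n => [|n IHn]; first by rewrite big_ord0 qprod_sum0 subrr.
by rewrite big_ord_recr /= IHn qprod_sumS -!natr1; ring.
Qed.

(** * Uchimura's identity for nilpotent [q] *)

Section Nilpotent.
Variable N : nat.
Hypothesis qN0 : q ^+ N = 0.

Lemma qpow_eq0 k : (N <= k)%N -> q ^+ k = 0.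
Proof. by move=> leNk; rewrite -(subnK leNk) exprD qN0 mulr0. Qed.

(** Since [q^k] is nilpotent, [1 - q^k] is a unit whose inverse is a finite geometric series. *)
Lemma sub1_qpow_cancel k : (0 < k)%N -> injective ( *%R (1 - q ^+ k)).
Proof.
move=> k_gt0 x y; set u := 1 - q ^+ k => eq_xy.
have uV : (1 + \sum_(i < N) (q ^+ k) ^+ i.+1) * u = 1.
  rewrite mulrDl mul1r [X in _ + X]mulrC geometric_sum -exprM.
  by rewrite [_ ^+ (k * _)]qpow_eq0 ?subr0 ?subrK //; nia.
by rewrite -[x]mul1r -[y]mul1r -uV -!mulrA eq_xy.
Qed.

(** The series of [q^k/(1-q^k)]; for [k > 0] the omitted terms vanish. *)
Definition lambert_term k : R := \sum_(i < N) q ^+ (k * i.+1).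

Lemma lambert_termE k : (0 < k)%N -> (1 - q ^+ k) * lambert_term k = q ^+ k.
Proof.
move=> k_gt0; rewrite /lambert_term.
under eq_bigr do rewrite exprM.
by rewrite geometric_sum -exprM [_ ^+ (k * _)]qpow_eq0 ?subr0 //; nia.
Qed.

(* The specialisation at [z = q ^+ j] of the series
   [\sum_m c m * (z q) ^+ m * (q ^+ m.+1; q)_oo]. *)
Definition moment (c : nat -> R) j : R :=
  \sum_(m < N.+1) (c m * q ^+ (m * j.+1)) * qprod m N.

(** The difference puts a factor [1 - q^m] on the m-th term: it kills [m = 0] and otherwise extends
    [qprod m N] to [qprod m.-1 N]. Shifting [m] then leaves only a top term, which is zero by
    nilpotence. *)
Lemma moment_step c j :
  moment c j - moment c j.+1 = q ^+ j.+1 * moment (fun m => c m.+1) j.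
Proof.
rewrite /moment -sumrB big_ord_recl /= !mul0n subrr add0r.
rewrite big_ord_recr /= mulrDr [X in _ = _ + X]mulrA.
have -> : q ^+ j.+1 * (c N.+1 * q ^+ (N * j.+1)) = 0.
  by rewrite mulrCA -exprD qpow_eq0 ?mulr0 //; nia.
rewrite mul0r addr0 mulr_sumr; apply: eq_bigr => m _ /=.
rewrite /bump /= add1n (qprod_recl (ltn_ord m)).
by rewrite [(_ * j.+2)%N]mulnS mulSn !exprD !exprS; ring.
Qed.

Lemma moment1 j : moment (fun=> 1) j = qprod 0 j.
Proof.
elim: j => [|j IHj].
  rewrite /qprod big_geq // -[RHS](sum_qpow_qprod N); apply: eq_bigr => m _.
  by rewrite mul1r muln1.
rewrite qprod_recr // -IHj; have /= := moment_step (fun=> 1) j.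
by move=> h; rewrite mulrBl mul1r -h; ring.
Qed.

Lemma moment_index_step j :
  (1 - q ^+ j.+1) * moment (fun m => m%:R) j =
    moment (fun m => m%:R) j.+1 + q ^+ j.+1 * qprod 0 j.
Proof.
have -> : q ^+ j.+1 * qprod 0 j = moment (fun m => m%:R) j
    - moment (fun m => m%:R) j.+1 - q ^+ j.+1 * moment (fun m => m%:R) j.
  rewrite moment_step -mulrBr -moment1 /moment -sumrB; congr (_ * _).
  by apply: eq_bigr => m _; rewrite -natr1; ring.
by ring.
Qed.

(** Downward induction on [j], with [d = N - j]. At [j = N] all terms vanish; each step down divides
    by [1 - q^(j+1)] and so contributes one Lambert term. *)
Lemma moment_indexE d j : (j + d)%N = N ->
  moment (fun m => m%:R) j = qprod 0 j * \sum_(j <= k < N) lambert_term k.+1.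
Proof.
elim: d j => [|d IHd] j jdN.
  rewrite addn0 in jdN; rewrite jdN big_geq // mulr0 /moment big1 // => m _.
  case: (val m) => [|i]; first by rewrite !mul0r.
  by rewrite qpow_eq0 ?mulr0 ?mul0r //; nia.
apply: (@sub1_qpow_cancel j.+1) => //=.
have lt_jN : (j < N)%N by lia.
rewrite moment_index_step IHd ?addSnnS // qprod_recr //.
by rewrite (big_ltn lt_jN) -[X in _ + X * _](@lambert_termE j.+1) //; ring.
Qed.

(* Uchimura's identity. *)
Lemma sum_qpow_qprod_sum_lambert :
  \sum_(k < N) q ^+ k.+1 * qprod_sum k = \sum_(k < N) lambert_term k.+1.
Proof.
have := @moment_indexE N 0 (add0n N).
rewrite qprod_nn mul1r big_mkord => <-.
rewrite sum_qpow_qprod_sum -sum_index_qpow_qprod; apply: eq_bigr => m _.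
by rewrite muln1.
Qed.

(** Here [a k] plays the role of [A_(k+1)]. After multiplication by [1 - q] every sum becomes
    explicit in [qprod_sum], and the combination telescopes. *)
Lemma sum_recurrence_lambert (a : nat -> R) :
    a 0 = 0 ->
    (forall k, a k.+1 = (1 - q ^+ k.+1) * a k + \sum_(i < k.+1) q ^+ i.+1) ->
  \sum_(k < N) q ^+ (k.+1 + k.+1) * a k =
    \sum_(k < N) \sum_(i < k.+1) q ^+ (k.+1 + i.+1)
      + \sum_(k < N) q ^+ k.+1 - \sum_(k < N) lambert_term k.+1.
Proof.
move=> a0 aS.
have aE k : (1 - q) * a k = q * (qprod_sum k - 1).
  elim: k => [|k IHk]; first by rewrite a0 qprod_sum0; ring.
  rewrite aS mulrDr geometric_sum mulrCA IHk qprod_sumS !exprS; ring.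
(* The geometric sum is known below only through these two properties, which reduces the induction
   to a polynomial identity. *)
have [G [GE doubleE]] : exists G : nat -> R,
    (forall k, (1 - q) * G k = q - q ^+ k.+2) /\
    (forall k, \sum_(i < k.+1) q ^+ (k.+1 + i.+1) = q ^+ k.+1 * G k).
  exists (fun k => \sum_(i < k.+1) q ^+ i.+1); split=> k.
    exact: geometric_sum.
  by rewrite mulr_sumr; apply: eq_bigr => i _; rewrite exprD.
(* The right-hand side is the exact remainder after [n] terms; at [n = N] it vanishes because
   [q^(N+1) = 0]. *)
have partial n : (1 - q) * (\sum_(k < n) q ^+ (k.+1 + k.+1) * a k
    - \sum_(k < n) \sum_(i < k.+1) q ^+ (k.+1 + i.+1)
    - \sum_(k < n) q ^+ k.+1 + \sum_(k < n) q ^+ k.+1 * qprod_sum k)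
    = q ^+ n.+1 * (1 - qprod_sum n).
  under [X in _ - X - _ + _]eq_bigr do rewrite doubleE.
  elim: n => [|n IHn]; first by rewrite !big_ord0 qprod_sum0; ring.
  have -> : q ^+ n.+2 * (1 - qprod_sum n.+1) = q ^+ n.+1 * (1 - qprod_sum n)
    + (q ^+ (n.+1 + n.+1) * (q * (qprod_sum n - 1))
       - q ^+ n.+1 * (q - q ^+ n.+2)
       - (1 - q) * q ^+ n.+1 + (1 - q) * (q ^+ n.+1 * qprod_sum n)).
    by rewrite qprod_sumS !exprD !exprS; ring.
  by rewrite -IHn -aE -GE !big_ord_recr /=; ring.
rewrite -sum_qpow_qprod_sum_lambert.
apply/eqP; rewrite -subr_eq0; apply/eqP.
apply: (@sub1_qpow_cancel 1) => //=; rewrite mulr0 expr1.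
transitivity (q ^+ N.+1 * (1 - qprod_sum N)); last first.
  by rewrite qpow_eq0 ?mul0r.
by rewrite -partial; ring.
Qed.

End Nilpotent.
End QSeries.

(** * Strictly decreasing lists of bounded parts and their signed gaps *)

Fixpoint distinct_parts k : seq (seq nat) :=
  if k is k'.+1 then
    distinct_parts k' ++ [seq k :: t | t <- distinct_parts k']
  else [:: [::]].

Lemma mem_distinct_parts k t :
  (t \in distinct_parts k) = path gtn k.+1 t && (0%N \notin t).
Proof.
elim: k t => [|k IHk] [|x t] //=.
- by rewrite !inE /=; case: x => [|x] //=; rewrite andbF.
- by rewrite mem_cat IHk.
rewrite mem_cat IHk /= !inE !negb_or.
have [->|x_neq] := eqVneq x k.+1.
  rewrite mem_map; last by move=> ? ? [].
  by rewrite IHk ltnn ltnSn.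
have -> : (x < k.+2)%N = (x < k.+1)%N by lia.
have -> : (x :: t \in [seq k.+1 :: t0 | t0 <- distinct_parts k]) = false.
  by apply/mapP => -[u _ [xk _]]; rewrite xk eqxx in x_neq.
by rewrite orbF.
Qed.

Lemma uniq_distinct_parts k : uniq (distinct_parts k).
Proof.
elim: k => //= k IHk; rewrite cat_uniq IHk map_inj_uniq ?IHk; last first.
  by move=> ? ? [].
rewrite andbT; apply/hasPn => _ /mapP[t _ ->].
by rewrite mem_distinct_parts /= ltnn.
Qed.

(* [num_parts], [second_smallest] and [smallest] of a partition, read off its
   list of parts. *)
Definition gap_weight (s : seq nat) : int :=
  (-1) ^+ (size s - 1)%N * ((nth 0%N (rev s) 1)%:Z - (nth 0%N (rev s) 0)%:Z).

(** Raising the repeated top part changes a gap only when [t] has one part: then the top is itself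
    the second smallest part, and with three parts the sign is positive. *)
Lemma gap_weight_incr_top k t : t != [::] ->
  gap_weight [:: k.+1, k.+1 & t] =
    gap_weight [:: k, k & t] + (size t == 1%N)%:Z.
Proof.
case/lastP: t => // t a _; rewrite /gap_weight /= !subn1 /=.
rewrite -!rcons_cons !rev_rcons /= !size_rcons.
case/lastP: t => [|t b] /=; first by rewrite intS; ring.
by rewrite -!rcons_cons !rev_rcons /= size_rcons addr0.
Qed.

(** The two smallest values are unchanged ([k] is second smallest on both sides if [t] has one
    part), while the number of parts grows by one. *)
Lemma gap_weight_add_part k t : t != [::] ->
  gap_weight [:: k.+1, k.+1, k & t] = - gap_weight [:: k, k & t].
Proof.
case/lastP: t => // t a _; rewrite /gap_weight /= !subn1 /=.
rewrite -!rcons_cons !rev_rcons /= !size_rcons.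
case/lastP: t => [|t b] /=; first by rewrite !exprS; ring.
by rewrite -!rcons_cons !rev_rcons /= size_rcons !exprS; ring.
Qed.

Section GapSum.
Variables (R : comNzRingType) (q : R).

(** This is [A_(k+1)]. The exponent omits the two copies of [k.+1]; their factor [q^(2k+2)] is
    supplied separately. *)
Definition gap_sum k : R :=
  \sum_(t <- distinct_parts k | t != [::])
    q ^+ sumn t *~ gap_weight [:: k.+1, k.+1 & t].

Lemma sum_distinct_parts_nil (F : seq nat -> R) k :
  \sum_(t <- distinct_parts k | t == [::]) F t = F [::].
Proof.
elim: k => [|k IHk] /=; first by rewrite big_cons big_nil addr0.
by rewrite big_cat /= IHk big_map big_pred0 ?addr0.
Qed.

Lemma sum_distinct_parts_single k :
  \sum_(t <- distinct_parts k | size t == 1%N) q ^+ sumn t =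
    \sum_(i < k) q ^+ i.+1.
Proof.
elim: k => [|k IHk] /=; first by rewrite big_cons big_nil big_ord0.
rewrite big_cat /= IHk big_map big_ord_recr /=; congr (_ + _).
under eq_bigl do rewrite eqSS size_eq0.
by rewrite sum_distinct_parts_nil /= addn0.
Qed.

Lemma gap_sum0 : gap_sum 0 = 0.
Proof. by rewrite /gap_sum /= big_cons big_nil. Qed.

(** Lists are split by whether they contain [k.+1]. Those without it give [gap_sum k] plus a
    correction from one-part lists; those with it give [- q^(k+1) gap_sum k], and the list
    [[:: k.+1]] alone supplies the last power of the geometric sum. *)
Lemma gap_sumS k :
  gap_sum k.+1 = (1 - q ^+ k.+1) * gap_sum k + \sum_(i < k.+1) q ^+ i.+1.
Proof.
rewrite /gap_sum /= big_cat /= big_map /=.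
rewrite [X in _ + X](bigID (fun t => t == [::])) /=.
rewrite sum_distinct_parts_nil /= big_ord_recr /= -sum_distinct_parts_single.
rewrite addn0; have -> : gap_weight [:: k.+2; k.+2; k.+1] = 1.
  by rewrite /gap_weight /= (intS k.+1); ring.
rewrite mulr1z mulrBl mul1r.
have -> : \sum_(t <- distinct_parts k | t != [::])
     q ^+ sumn t *~ gap_weight [:: k.+2, k.+2 & t] =
     gap_sum k + \sum_(t <- distinct_parts k | size t == 1%N) q ^+ sumn t.
  under eq_bigr => t t0 do rewrite gap_weight_incr_top // mulrzDr.
  rewrite big_split /=; congr (_ + _).
  rewrite [RHS]big_mkcond [LHS]big_mkcond; apply: eq_bigr => t _.
  by case: t => [|x [|y t]] //=; rewrite ?mulr0z ?mulr1z.
have -> : \sum_(t <- distinct_parts k | t != [::])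
     q ^+ (k.+1 + sumn t) *~ gap_weight [:: k.+2, k.+2, k.+1 & t] =
     - (q ^+ k.+1 * gap_sum k).
  rewrite mulr_sumr -sumrN; apply: eq_bigr => t t0.
  by rewrite gap_weight_add_part // mulrNz exprD mulrzAr.
by rewrite /gap_sum; ring.
Qed.

End GapSum.

(** * Explicit enumeration of [Dstar n] *)

Lemma Dstar_shapeP n (s : seq nat) :
  (exists2 p, p \in Dstar n & val p = s) <->
  (exists k t, [/\ t \in distinct_parts k, t != [::],
                   s = [:: k.+1, k.+1 & t] & sumn s = n]).
Proof.
split.
  case=> -[s' s'P]; rewrite inE => /andP[]; rewrite inE => /= s'D + <- {s}.
  rewrite /largest /num_parts /= in s'D * => /andP[/eqP s'2 s'3].
  move: s'P => /and3P[s's s'0 /eqP s'n].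
  case: s' s'D s'2 s'3 s's s'0 s'n => [|x [|y u]] //=.
  move=> /and3P[_ _ uD] u2 u_size /andP[le_yx yu] u0 us.
  have ux : path geq x u.
    by case: u yu {uD u2 u_size u0 us} => //= z u /andP[le_zy ->]; lia.
  (* If [y < x], all later parts are below [x] as well, and [x] would occur only once. *)
  have yx : y = x.
    apply/eqP; apply: contraT => neq_yx.
    have : x \notin u.
      have /order_path_min : path geq y u by [].
      move=> /(_ (rev_trans leq_trans)) /allP le_u.
      by apply/negP => /le_u; lia.
    by move/count_memPn; rewrite eqxx (negPf neq_yx) in u2 * => u0'; rewrite u0' in u2.
  subst y; have xu : x \notin u.
    by apply/count_memPn; move: u2; rewrite eqxx => -[].
  (* A part of [u] differs from the largest part [x], so membership in [D1] forbids its
     repetition. *)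
  have uu : uniq u.
    apply: count_mem_uniq => i.
    have [iu|/count_memPn //] := boolP (i \in u).
    have neq_ix : x != i by apply: contraNneq xu => ->.
    move/allP: uD => /(_ i); rewrite iu => /(_ isT).
    rewrite (negPf neq_ix) eq_sym (negPf neq_ix) implybF -leqNgt.
    have : (0 < count_mem i u)%N by rewrite -has_count has_pred1.
    by rewrite !add0n; case: (count_mem i u) => [|[|c]].
  case: x {uD u2 le_yx} => [|k] in yu u0 us ux xu *.
    by rewrite inE eqxx in u0.
  exists k, u; split=> //; last by case: (u) u_size.
  rewrite mem_distinct_parts.
  have := gtn_sorted_uniq_geq (k.+1 :: u) => /= ->; rewrite xu uu ux /=.
  by apply: contra u0 => u0; rewrite !inE u0 !orbT.
case=> k [t [tk t_nil -> sn]]; move: tk; rewrite mem_distinct_parts.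
have /= -> := gtn_sorted_uniq_geq (k.+1 :: t).
move=> /andP[/andP[/andP[kt tu] ts] t0].
have sP : is_intpart n [:: k.+1, k.+1 & t].
  by rewrite /is_intpart sn eqxx andbT /= leqnn ts !inE.
exists (IntPart sP) => //; rewrite inE inE /largest /num_parts /=.
rewrite eqxx (count_memPn kt) addn0 /=; apply/andP; split.
  apply/allP => i it.
  have neq_ik : k.+1 != i by apply: contraNneq kt => ->.
  by rewrite (negPf neq_ik) (count_uniq_mem _ tu) it.
by case: t t_nil {kt tu ts t0 sn sP}.
Qed.

(** The pair [(k, t)] can be read off the list, so no partition is counted twice; the bound on [k]
    loses nothing because [k.+1] is a part of a partition of [n]. *)
Lemma sum_Dstar n (F : seq nat -> int) :
  \sum_(p in Dstar n) F p =
  \sum_(k < n.+1) \sum_(t <- distinct_parts k |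
      (t != [::]) && (k.+1 + k.+1 + sumn t == n)%N) F [:: k.+1, k.+1 & t].
Proof.
pose T k := [seq t <- distinct_parts k |
  (t != [::]) && (k.+1 + k.+1 + sumn t == n)%N].
pose r := [seq [:: k.+1, k.+1 & t] | k <- iota 0 n.+1, t <- T k].
transitivity (\sum_(s <- r) F s); last first.
  rewrite big_allpairs_dep -[iota _ _]/(index_iota 0 n.+1) big_mkord.
  by apply: eq_bigr => k _; rewrite big_filter.
rewrite -big_enum -(big_map val xpredT); apply: perm_big.
apply: uniq_perm.
- by rewrite map_inj_uniq ?enum_uniq //; apply: val_inj.
- apply: allpairs_uniq_dep => [|k _|]; rewrite ?iota_uniq //.
    by rewrite filter_uniq ?uniq_distinct_parts.
  by move=> [k t] [k' t'] _ _ /= [-> _ ->].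
move=> s; apply/mapP/allpairsPdep.
  case=> p; rewrite mem_enum => pD ps.
  have /Dstar_shapeP[k [t [tk t0 -> sn]]] : exists2 p, p \in Dstar n & val p = s.
    by exists p.
  exists k, t; split=> //; rewrite ?mem_filter ?tk ?t0 ?mem_iota.
    by rewrite -sn /=; lia.
  by rewrite -sn /= addnA eqxx.
case=> k [t [_ + ->]]; rewrite mem_filter => /andP[/andP[t0 /eqP sn] tk].
have /Dstar_shapeP[p pD ps] : exists k' t', [/\ t' \in distinct_parts k',
    t' != [::], [:: k.+1, k.+1 & t] = [:: k'.+1, k'.+1 & t']
    & sumn [:: k.+1, k.+1 & t] = n].
  by exists k, t; split=> //=; rewrite addnA.
by exists p; rewrite ?mem_enum.
Qed.

(** * Passage between polynomials and their residues modulo [X^(n+1)] *)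

Lemma rmorph_gap_sum (R S : comNzRingType) (f : {rmorphism R -> S}) (x : R) k :
  f (gap_sum x k) = gap_sum (f x) k.
Proof.
by rewrite rmorph_sum; apply: eq_bigr => t _; rewrite rmorphMz rmorphXn.
Qed.

Lemma in_qpolyXn_coef (R : comNzRingType) n (p p' : {poly R}) i :
  in_qpoly 'X^(n.+1) p = in_qpoly 'X^(n.+1) p' -> (i < n.+1)%N -> p`_i = p'`_i.
Proof.
move=> /(congr1 val) /=; rewrite mk_monic_Xn /= => eq_mod lt_in.
rewrite (Pdiv.RingMonic.rdivp_eq (monicXn R n.+1) p).
rewrite (Pdiv.RingMonic.rdivp_eq (monicXn R n.+1) p') eq_mod.
by rewrite !coefD !coefMXn lt_in.
Qed.

Lemma qpolyX_expn (R : comNzRingType) n :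
  (in_qpoly 'X^(n.+1) 'X : {poly %/ ('X^(n.+1) : {poly R})}) ^+ n.+1 = 0.
Proof.
rewrite -rmorphXn /=; apply/val_inj => /=.
by rewrite mk_monic_Xn Pdiv.RingMonic.rmodpp ?monicXn.
Qed.

Lemma coef_sum_gap_sum n :
  (\sum_(k < n.+1) 'X^(k.+1 + k.+1) * gap_sum 'X k : {poly int})`_n =
    \sum_(p in Dstar n) gap_weight p.
Proof.
rewrite sum_Dstar coef_sum; apply: eq_bigr => k _.
rewrite mulr_sumr coef_sum [RHS]big_mkcondr; apply: eq_bigr => t _ /=.
rewrite mulrzAr -exprD coefMrz coefXn eq_sym.
by case: eqP => _; rewrite ?mul0rz // intz.
Qed.

(** * Counting two-part partitions and divisors *)

Lemma sum_ord_eq m j : (\sum_(i < m) (i == j :> nat) = (j < m))%N.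
Proof.
have [lt_jm|le_mj] := ltnP j m.
  rewrite (bigD1 (Ordinal lt_jm)) //= eqxx big1 // => i.
  by rewrite -val_eqE /= => /negPf ->.
by apply: big1 => i _; have := ltn_ord i; case: eqP => // ->; lia.
Qed.

Lemma sum_two_parts n : (0 < n)%N ->
  (\sum_(k < n.+1) \sum_(i < k.+1) (n == k.+1 + i.+1) = n %/ 2)%N.
Proof.
move=> n_gt0.
have inner k : (\sum_(i < k.+1) (n == k.+1 + i.+1) = (k.+2 <= n <= k.+1.*2))%N.
  have [le_kn|lt_nk] := leqP k.+2 n; last first.
    by apply: big1 => i _; apply/eqP; rewrite eqb0; lia.
  have -> : (n <= k.+1.*2)%N = (n - k.+2 < k.+1)%N by lia.
  by rewrite -sum_ord_eq; apply: eq_bigr => i _; congr nat_of_bool; lia.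
under eq_bigr do rewrite inner.
(* The condition means [(n-1) %/ 2 <= k < n-1]; the right-hand side counts such [k] below [m]. *)
have partial m : (\sum_(k < m) (k.+2 <= n <= k.+1.*2) =
    minn m n.-1 - minn m (n.-1 %/ 2))%N.
  elim: m => [|m IHm]; first by rewrite big_ord0; lia.
  by rewrite big_ord_recr /= IHm; lia.
by rewrite partial; lia.
Qed.

Lemma sum_divisor_pairs n : (0 < n)%N ->
  (\sum_(k < n.+1) \sum_(i < n.+1) (n == k.+1 * i.+1) = size (divisors n))%N.
Proof.
move=> n_gt0.
have inner k : (\sum_(i < n.+1) (n == k.+1 * i.+1) = (k.+1 %| n))%N.
  have [/dvdnP[c nE]|ndvd] := boolP (k.+1 %| n)%N; last first.
    apply: big1 => i _; apply/eqP; rewrite eqb0.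
    by apply: contraNneq ndvd => ->; apply: dvdn_mulr.
  have c_gt0 : (0 < c)%N by lia.
  (* The only solution is [i = c.-1], where [c] is the cofactor of [k.+1]. *)
  transitivity ((c.-1 < n.+1) : nat)%N; last by rewrite nE; nia.
  rewrite -sum_ord_eq; apply: eq_bigr => i _; congr nat_of_bool.
  by rewrite [X in X == _]nE mulnC eqn_pmul2l //; lia.
under eq_bigr do rewrite inner.
have /perm_size -> : perm_eq (divisors n) [seq d <- iota 1 n.+1 | d %| n]%N.
  apply: uniq_perm; rewrite ?divisors_uniq ?filter_uniq ?iota_uniq // => d.
  rewrite mem_filter -dvdn_divisors // mem_iota.
  by case: (boolP (d %| n)%N) => //= dn; have := dvdn_leq n_gt0 dn;
     have := dvdn_gt0 n_gt0 dn; lia.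
rewrite size_filter -sum1_count.
rewrite -[iota 1 _]/(index_iota 1 n.+2) big_add1 big_mkord [RHS]big_mkcond /=.
by apply: eq_bigr => k _; case: ifP.
Qed.

Theorem theorem2p8 (n : nat) (n_gt0 : (0 < n)%N) :
  (size (divisors n))%:Z =
    1 + (n %/ 2)%N%:Z
      - \sum_(p in Dstar n)
          (-1) ^+ (num_parts p - 1)%N
            * ((second_smallest p)%:Z - (smallest p)%:Z).
Proof.
rewrite -[X in _ - X]/(\sum_(p in Dstar n) gap_weight p) -coef_sum_gap_sum.
have := sum_recurrence_lambert (qpolyX_expn int n) (gap_sum0 _) (gap_sumS _).
move=> qE.
(* The identity holds only modulo [X^(n+1)], which still determines the coefficient of index [n]. *)
have -> : (\sum_(k < n.+1) 'X^(k.+1 + k.+1) * gap_sum 'X k : {poly int})`_n =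
  (\sum_(k < n.+1) \sum_(i < k.+1) 'X^(k.+1 + i.+1)
    + \sum_(k < n.+1) 'X^(k.+1)
    - \sum_(k < n.+1) \sum_(i < n.+1) 'X^(k.+1 * i.+1) : {poly int})`_n.
  apply: (@in_qpolyXn_coef _ n) => //; rewrite rmorphB rmorphD !rmorph_sum /=.
  under eq_bigr do rewrite rmorphM rmorphXn /= rmorph_gap_sum.
  rewrite qE; congr (_ + _ - _).
  - apply: eq_bigr => k _; rewrite rmorph_sum.
    by apply: eq_bigr => i _; rewrite rmorphXn.
  - by apply: eq_bigr => k _; rewrite rmorphXn.
  - apply: eq_bigr => k _; rewrite rmorph_sum.
    by apply: eq_bigr => i _; rewrite rmorphXn.
have coefE (I : finType) (P : I -> nat) :
    (\sum_i 'X^(P i) : {poly int})`_n = (\sum_i (n == P i) : nat)%N%:Z.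
  rewrite coef_sum -natz natr_sum; apply: eq_bigr => i _.
  by rewrite coefXn.
have coef2E (m : nat) (h : 'I_m -> nat) (P : forall k : 'I_m, 'I_(h k) -> nat) :
    (\sum_(k < m) \sum_(i < h k) 'X^(P k i) : {poly int})`_n =
      (\sum_(k < m) \sum_(i < h k) (n == P k i) : nat)%N%:Z.
  rewrite coef_sum -natz natr_sum; apply: eq_bigr => k _.
  by rewrite coefE natz.
rewrite coefB coefD !coef2E coefE sum_two_parts // sum_divisor_pairs //.
(* The series [q/(1-q)] contributes the constant 1, through [k = n.-1]. *)
have -> : (\sum_(k < n.+1) (n == k.+1) = 1)%N.
  transitivity ((n.-1 < n.+1) : nat)%N; last by lia.
  by rewrite -sum_ord_eq; apply: eq_bigr => i _; congr nat_of_bool; lia.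
by ring.
Qed.
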